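(* Let $n,k,i,j$ be integers with $1\le k\le n$, $0\le i\le k-1$ and $0\le j\le n-k$. Then the coefficient of $\alpha^{k-1-i}\beta^{i}\lambda^{n-k-j}\mu^{j}$ in the polynomial $\mathbb{S}(n,k;\alpha,\beta,\lambda,\mu)$ satisfies $$[\alpha^{k-1-i}\beta^{i}\lambda^{n-k-j}\mu^{j}]\,\mathbb{S}(n,k;\alpha,\beta,\lambda,\mu)=\left|\left\{\pi\in\mathrm{LLP}_{n,k}: \mathrm{rlb}(\pi)=k-1-i,\ \mathrm{nsb}(\pi)=i,\ \mathrm{rle}(\pi)=n-k-j,\ \mathrm{nse}(\pi)=j\right\}\right|$$ $$=\begin{bmatrix}n\\ n-j\end{bmatrix}\left\{\begin{matrix}n-j\\ k\end{matrix}\right\}\begin{bmatrix}k\\ k-i\end{bmatrix}.$$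
   Context: $\mathrm{LLP}_{n,m}$ is the set of all ''list of lists'' partitions of $[n]=\{1,\dots,n\}$ into $m$ blocks: ordered sequences $\pi=B_1/B_2/\cdots/B_m$ of nonempty disjoint blocks with union $[n]$, where in addition the elements inside each block are linearly ordered (each block is a word $B_\ell=\sigma_1\cdots\sigma_{n_\ell}$). For $\pi\in\mathrm{LLP}_{n,m}$ define four statistics. (1) $\mathrm{rlb}(\pi)$ is the number of indices $j$ such that $\min B_j<\min B_l$ for all $l>j$ and $\min B_j>1$. (2) $\mathrm{nsb}(\pi)$ is the number of blocks that must be moved to the right to make the sequence of block minima increasing, i.e. the number of indices $j$ for which there is $l>j$ with $\min B_l<\min B_j$; thus $\mathrm{nsb}(\pi)+\mathrm{rlb}(\pi)=m-1$. (3) For a block $B_\ell=\sigma_1\cdots\sigma_{n_\ell}$, $\mathrm{rle}(B_\ell)$ is the number of indices $j$ such that $\sigma_j<\sigma_l$ for all $l>j$ and $\sigma_j>\min B_\ell$; and $\mathrm{rle}(\pi)=\sum_{\ell}\mathrm{rle}(B_\ell)$. (4) $\mathrm{nse}(\pi)$ is the total number of elements that must be moved to the right inside their blocks to make every block increasing, i.e. the number of elements that are followed, somewhere later in the same block, by a smaller element; thus $\mathrm{nse}(\pi)+\mathrm{rle}(\pi)=n-m$. Define $$\mathbb{S}(n,m;\alpha,\beta,\lambda,\mu)=\sum_{\pi\in\mathrm{LLP}_{n,m}}\alpha^{\mathrm{rlb}(\pi)}\beta^{\mathrm{nsb}(\pi)}\lambda^{\mathrm{rle}(\pi)}\mu^{\mathrm{nse}(\pi)},$$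 a polynomial in the indeterminates $\alpha,\beta,\lambda,\mu$. $\begin{bmatrix}n\\ k\end{bmatrix}$ is the unsigned Stirling number of the first kind and $\left\{\begin{matrix}n\\ k\end{matrix}\right\}$ the Stirling number of the second kind. *)

(* Defs.v *)
From HB Require Import structures.
From mathcomp Require Import all_boot all_order all_fingroup all_algebra.
From mathcomp.multinomials Require Export mpoly.

Set Implicit Arguments.
Unset Strict Implicit.
Unset Printing Implicit Defensive.

Import GRing.Theory.
Local Open Scope nat_scope.

(* Blocks are words over {0, ..., n} of length at most n, so that the type is
   finite; [is_LLP] forces the letters to be exactly 1, ..., n, each used once,
   and then the length bound is no restriction. *)
Definition llp_carrier (n m : nat) := m.-tuple (n.-bseq 'I_n.+1).

Definition blocks (n m : nat) (p : llp_carrier n m) : seq (seq nat) :=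
  [seq [seq nat_of_ord x | x <- bseqval B] | B <- tval p].

Definition is_LLP (n : nat) (bs : seq (seq nat)) : bool :=
  all (fun B => B != [::]) bs && perm_eq (flatten bs) (iota 1 n).

Definition LLP (n m : nat) : {set llp_carrier n m} :=
  [set p : llp_carrier n m | is_LLP n (blocks p)].

(* The default value [head 0 B] only matters for the empty word. *)
Definition minw (B : seq nat) : nat := \big[minn/head 0 B]_(x <- B) x.

Definition rlmin_above (c : nat) (w : seq nat) : nat :=
  #|[set j : 'I_(size w) |
      [forall l : 'I_(size w), (j < l) ==> (nth 0 w j < nth 0 w l)]
      && (c < nth 0 w j)]|.

Definition followed_by_smaller (w : seq nat) : nat :=
  #|[set j : 'I_(size w) |
      [exists l : 'I_(size w), (j < l) && (nth 0 w l < nth 0 w j)]]|.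

Definition rlb (n m : nat) (p : llp_carrier n m) : nat :=
  rlmin_above 1 [seq minw B | B <- blocks p].

Definition nsb (n m : nat) (p : llp_carrier n m) : nat :=
  followed_by_smaller [seq minw B | B <- blocks p].

Definition rle (n m : nat) (p : llp_carrier n m) : nat :=
  \sum_(B <- blocks p) rlmin_above (minw B) B.

Definition nse (n m : nat) (p : llp_carrier n m) : nat :=
  \sum_(B <- blocks p) followed_by_smaller B.

(* The indeterminates alpha, beta, lambda, mu are 'X_0, 'X_1, 'X_2, 'X_3. *)
Definition SS (n m : nat) : {mpoly int[4]} :=
  (\sum_(p in LLP n m)
     'X_(inord 0) ^+ rlb p * 'X_(inord 1) ^+ nsb p
     * 'X_(inord 2) ^+ rle p * 'X_(inord 3) ^+ nse p)%R.

(* Unsigned Stirling numbers of the first kind: permutations of n points with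
   k cycles, fixed points included ([porbits] is the set of all orbits). *)
Definition stirling1 (n k : nat) : nat :=
  #|[set s : 'S_n | #|porbits s| == k]|.

Definition stirling2 (n k : nat) : nat :=
  #|[set P : {set {set 'I_n}} | partition P [set: 'I_n] && (#|P| == k)]|.

(* Main.v *)
Require Import Defs.
From HB Require Import structures.
From mathcomp Require Import all_boot all_order all_fingroup all_algebra.
From mathcomp.multinomials Require Import mpoly.
From mathcomp Require Import zify.

(** Build the lists of lists on [1..n+1] from those on [1..n] by inserting the
    largest letter.  As a new singleton block it never changes [nse], and raises
    [nsb] by one except in the last of the k+1 positions.  Inside an existing
    block it never changes a block minimum, hence not [nsb]; it raises [nse] by
    one in front of each of the n letters, and by zero at the end of each of the
    k blocks.  The resulting recurrence factors through the usual recurrences of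
    the Stirling numbers of both kinds. *)

(** * Words and their statistics *)

Lemma card_ordS n (P : pred 'I_n.+1) :
  #|[set j | P j]| = P ord0 + #|[set j | P (lift ord0 j)]|.
Proof. by rewrite -!sum1dep_card big_mkcond big_ord_recl -big_mkcond; case: (P _). Qed.

Lemma has_nth_ord {T : Type} (x0 : T) (p : pred T) w :
  has p w = [exists l : 'I_(size w), p (nth x0 w l)].
Proof.
apply/(has_nthP x0)/existsP => [[i lt_iw pi]|[i pi]]; last by exists (val i); rewrite ?ltn_ord.
by exists (Ordinal lt_iw).
Qed.

(** Splitting off the first index replaces the cardinality by a recursion on the word, which the
    later inductions use. *)
Lemma followed_by_smaller_cons y w :
  followed_by_smaller (y :: w) =
    has (fun z => z < y) w + followed_by_smaller w.
Proof.
rewrite /followed_by_smaller card_ordS; congr (nat_of_bool _ + _).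
  rewrite (has_nth_ord 0); apply/existsP/existsP => /= [[l /andP[lt0l]]|[l ltl]].
    by case: (unliftP ord0 l) lt0l => [l' ->|->] // _ lt; exists l'.
  by exists (lift ord0 l).
apply: eq_card => j; rewrite !inE.
apply/existsP/existsP => /= [[l /andP[ltjl]]|[l ltl]].
  by case: (unliftP ord0 l) ltjl => [l' ->|->] // ltjl lt; exists l'; apply/andP.
by exists (lift ord0 l).
Qed.

Lemma rlmin_above_cons c y w :
  rlmin_above c (y :: w) = all (fun z => y < z) w && (c < y) + rlmin_above c w.
Proof.
rewrite /rlmin_above card_ordS; congr (nat_of_bool (_ && _) + _).
  rewrite -[all _ w]negbK -has_predC (has_nth_ord 0) negb_exists.
  apply/forallP/forallP => /= [h l|h l]; first by rewrite negbK; exact: (h (lift ord0 l)).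
  by case: (unliftP ord0 l) => [l' ->|->] //=; move: (h l'); rewrite negbK.
apply: eq_card => j; rewrite !inE; congr (_ && _).
apply/forallP/forallP => /= h l; first exact: (h (lift ord0 l)).
by case: (unliftP ord0 l) => [l' ->|->] //; apply: h.
Qed.

Lemma followed_by_smaller_nil : followed_by_smaller [::] = 0.
Proof. by apply: eq_card0 => -[]. Qed.

Lemma rlmin_above_nil c : rlmin_above c [::] = 0.
Proof. by apply: eq_card0 => -[]. Qed.

(** As the letters are distinct, each position is either a right-to-left minimum or followed by
    something smaller. The strict bound discards exactly the occurrence of [c], if any. With this,
    [rlb] and [rle] are determined by [nsb] and [nse]. *)
Lemma rlmin_above_followed_by_smaller c w : uniq w -> all (leq c) w ->
  rlmin_above c w + followed_by_smaller w + (c \in w) = size w.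
Proof.
elim: w => [|y w IHw] /=; first by rewrite rlmin_above_nil followed_by_smaller_nil.
case/andP=> yNw uw /andP[le_cy cw].
have {IHw} <- := IHw uw cw.
rewrite rlmin_above_cons followed_by_smaller_cons in_cons.
case: (eqVneq c y) cw => [-> cw|c_neq_y _].
  rewrite ltnn andbF (negPf yNw) /=.
  suff -> : has (fun z => z < y) w = false by lia.
  apply/hasPn => z zw; rewrite -leqNgt.
  exact: (allP cw).
have lt_cy : c < y by rewrite ltn_neqAle c_neq_y.
rewrite lt_cy andbT /=.
suff -> : has (fun z => z < y) w = ~~ all (fun z => y < z) w by case: all; lia.
rewrite -has_predC; apply: eq_in_has => z zw /=.
have : z != y by apply: contraNneq yNw => <-.
by lia.
Qed.

Lemma minw_mem w : w != [::] -> minw w \in w.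
Proof.
rewrite /minw; case: w => [|y w] // _ /=.
(* The fold starts from the head [y], so [y] is kept as an extra admissible value while the folded
   list shrinks. *)
suff: \big[minn/y]_(x <- y :: w) x \in [:: y, y & w].
  by rewrite inE => /predU1P[->|] //; rewrite mem_head.
elim: (y :: w) => [|z s IHs]; first by rewrite big_nil mem_head.
rewrite big_cons /minn; case: ifP => _; move: IHs; rewrite !inE ?eqxx ?orbT //.
by case/orP=> ->; rewrite ?orbT.
Qed.

Lemma minw_le w : {in w, forall x, minw w <= x}.
Proof.
(* The starting value is generalised, since passing to the tail would change the head. *)
rewrite /minw; move: (head 0 w) => d; elim: w => [|y w IHw] // x.
rewrite inE big_cons geq_min => /predU1P[->|/IHw ->]; by rewrite ?leqnn ?orbT.
Qed.

Lemma minw_eq w c : c \in w -> {in w, forall x, c <= x} -> minw w = c.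
Proof.
move=> cw le_cw; apply/eqP; rewrite eqn_leq minw_le // le_cw // minw_mem //.
by case: w cw {le_cw}.
Qed.

(** * Inserting a new letter *)

Fixpoint insertions {T : Type} (x : T) (w : seq T) : seq (seq T) :=
  if w is y :: w' then (x :: w) :: map (cons y) (insertions x w')
  else [:: [:: x]].

Lemma insertionsP {T : eqType} (x : T) w w' :
  reflect (exists u v, w = u ++ v /\ w' = u ++ x :: v) (w' \in insertions x w).
Proof.
elim: w w' => [|y w IHw] w' /=; rewrite inE.
  apply: (iffP eqP) => [->|[[|? ?] [[|? ?] []]] //]; by exists [::], [::].
apply: (iffP predU1P) => [[->|/mapP[w1 /IHw[u [v [-> ->]]] ->]]|].
- by exists [::], (y :: w).
- by exists (y :: u), v.
case=> -[|z u] [v [/= e ->]]; first by left; rewrite e.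
case: e => -> e; right; apply: map_f; apply/IHw; by exists u, v.
Qed.

Lemma map_insertions {S T : Type} (f : S -> T) x w :
  map (map f) (insertions x w) = insertions (f x) (map f w).
Proof. by elim: w => //= y w <-; rewrite -!map_comp. Qed.

Lemma perm_insertions {T : eqType} (x : T) w w' :
  w' \in insertions x w -> perm_eq w' (x :: w).
Proof. by case/insertionsP=> u [v [-> ->]]; rewrite -cat1s perm_catCA. Qed.

Lemma uniq_insertions {T : eqType} (x : T) w : x \notin w -> uniq (insertions x w).
Proof.
elim: w => //= y w IHw; rewrite inE negb_or => /andP[x_neq_y xNw].
rewrite map_inj_uniq ?IHw // => [|? ? [] //]; rewrite andbT.
by apply/mapP=> -[? _ [/eqP]]; rewrite (negPf x_neq_y).
Qed.

(** The letter [x] exceeds all others, so it never makes another letter count, and it counts itself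
    unless it comes last. [insertions] lists the positions from left to right, so the end position
    is the final entry. *)
Lemma followed_by_smaller_insertions x w : all (fun z => z < x) w ->
  map followed_by_smaller (insertions x w) =
    rcons (nseq (size w) (followed_by_smaller w).+1) (followed_by_smaller w).
Proof.
elim: w => [|y w IHw] /=.
  by rewrite followed_by_smaller_cons followed_by_smaller_nil.
case/andP=> lt_yx ltwx; rewrite followed_by_smaller_cons /= lt_yx; congr (_ :: _).
transitivity (map (addn (has (fun z => z < y) w))
                (map followed_by_smaller (insertions x w))).
  rewrite -!map_comp; apply/eq_in_map => w' /perm_insertions pw' /=.
  rewrite followed_by_smaller_cons (perm_has _ pw') /=.
  by rewrite [x < y]ltnNge (ltnW lt_yx).
by rewrite IHw // map_rcons map_nseq followed_by_smaller_cons addnS.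
Qed.

Lemma minw_insertions x w w' : w != [::] -> all (fun z => z < x) w ->
  w' \in insertions x w -> minw w' = minw w.
Proof.
move=> w0 ltwx /perm_insertions pw'; apply: minw_eq => [|z]; rewrite (perm_mem pw') inE.
  by rewrite minw_mem ?orbT.
case/predU1P=> [->|/minw_le //]; exact/ltnW/(allP ltwx)/minw_mem.
Qed.

Fixpoint block_insertions {T : Type} (x : T) (bs : seq (seq T)) :=
  if bs is B :: bs' then
    [seq B' :: bs' | B' <- insertions x B] ++
    [seq B :: c | c <- block_insertions x bs']
  else [::].

Definition extensions {T : Type} (x : T) (bs : seq (seq T)) :=
  insertions [:: x] bs ++ block_insertions x bs.

Lemma block_insertionsP {T : eqType} (x : T) bs c :
  reflect (exists bs1 u v bs2,
             bs = bs1 ++ (u ++ v) :: bs2 /\ c = bs1 ++ (u ++ x :: v) :: bs2)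
          (c \in block_insertions x bs).
Proof.
elim: bs c => [|B bs IHbs] c /=.
  by right=> -[[|? ?] [u [v [bs2 []]]]].
rewrite mem_cat; apply: (iffP orP).
  case=> /mapP[].
    by move=> B' /insertionsP[u [v [-> ->]]] ->; exists [::], u, v, bs.
  by move=> c' /IHbs[bs1 [u [v [bs2 [-> ->]]]]] ->; exists (B :: bs1), u, v, bs2.
case=> -[|B1 bs1] [u [v [bs2 [/= [-> e] ->]]]]; [left; rewrite e|right]; apply: map_f.
  by apply/insertionsP; exists u, v.
by apply/IHbs; exists bs1, u, v, bs2.
Qed.

Lemma uniq_block_insertions {T : eqType} (x : T) bs :
  x \notin flatten bs -> uniq (block_insertions x bs).
Proof.
elim: bs => //= B bs IHbs; rewrite mem_cat negb_or => /andP[xNB xNbs].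
rewrite cat_uniq !map_inj_uniq => [|? ? [] //|? ? [] //].
rewrite uniq_insertions // IHbs //= andbT.
apply/hasPn=> c /mapP[c' _ ->]; apply/mapP=> -[B' /insertionsP[u [v [_ ->]]] [eB _]].
by rewrite eB mem_cat mem_head orbT in xNB.
Qed.

Lemma perm_flatten_extensions {T : eqType} (x : T) bs c :
  c \in extensions x bs -> perm_eq (flatten c) (x :: flatten bs).
Proof.
rewrite mem_cat => /orP[/perm_insertions/perm_flatten //|].
case/block_insertionsP=> bs1 [u [v [bs2 [-> ->]]]].
rewrite !flatten_cat /= -!catA (catA (flatten bs1) u) (catA (flatten bs1) u).
exact: permEl (perm_catCA _ [:: x] _).
Qed.

Lemma nonempty_extensions {T : eqType} (x : T) bs c :
  c \in extensions x bs -> all (fun B => B != [::]) bs ->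
  all (fun B => B != [::]) c.
Proof.
rewrite mem_cat => /orP[/perm_insertions/perm_all -> //|].
case/block_insertionsP=> bs1 [u [v [bs2 [-> ->]]]].
by rewrite !all_cat /= => /and3P[-> _ ->]; case: u.
Qed.

Lemma uniq_extensions {T : eqType} (x : T) bs :
  x \notin flatten bs -> uniq (extensions x bs).
Proof.
move=> xNbs; rewrite cat_uniq uniq_block_insertions // andbT uniq_insertions /=.
  apply/hasPn=> c /block_insertionsP[bs1 [u [v [bs2 [-> ->]]]]].
  apply/negP=> /perm_insertions/perm_size /=; rewrite !size_cat /=; lia.
by apply: contra xNbs => xbs; apply/flattenP; exists [:: x]; rewrite ?mem_head.
Qed.

(** The left inverse of extension: a block emptied by the deletion was the new singleton, hence it
    is dropped. *)
Definition delete_letter {T : eqType} (x : T) (c : seq (seq T)) :=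
  [seq B <- [seq filter (predC1 x) B | B <- c] | B != [::]].

Lemma delete_letter_id {T : eqType} (x : T) bs :
  all (fun B => B != [::]) bs -> x \notin flatten bs -> delete_letter x bs = bs.
Proof.
elim: bs => //= B bs IHbs /andP[B0 bs0]; rewrite mem_cat negb_or => /andP[xNB xNbs].
have eB : filter (predC1 x) B = B.
  by apply/all_filterP/allP=> y yB /=; apply: contraNneq xNB => <-.
by rewrite /delete_letter /= eB B0 -/(delete_letter x bs) IHbs.
Qed.

Lemma delete_letter_extensions {T : eqType} (x : T) bs c :
  all (fun B => B != [::]) bs -> x \notin flatten bs ->
  c \in extensions x bs -> delete_letter x c = bs.
Proof.
move=> bs0 xNbs; rewrite -{2}(delete_letter_id x bs) // mem_cat.
case/orP=> [/insertionsP[bs1 [bs2 [-> ->]]]|].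
  by rewrite /delete_letter !map_cat !filter_cat /= eqxx.
case/block_insertionsP=> bs1 [u [v [bs2 [-> ->]]]].
by rewrite /delete_letter !map_cat !filter_cat /= !filter_cat /= eqxx.
Qed.

(** * Enumeration of all lists of lists *)

Fixpoint llp_seq n : seq (seq (seq nat)) :=
  if n is n'.+1 then [seq c | bs <- llp_seq n', c <- extensions n bs]
  else [:: [::]].

Lemma perm_iotaS n : perm_eq (iota 1 n.+1) (n.+1 :: iota 1 n).
Proof. by rewrite -(addn1 n) iotaD perm_catC addnC. Qed.

Lemma is_LLP_extensions n bs c :
  is_LLP n bs -> c \in extensions n.+1 bs -> is_LLP n.+1 c.
Proof.
case/andP=> bs0 pbs cbs; rewrite /is_LLP (nonempty_extensions _ _ _ cbs) //=.
rewrite (perm_trans (perm_flatten_extensions _ _ _ cbs)) // perm_sym.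
by rewrite (permPl (perm_iotaS n)) perm_cons perm_sym.
Qed.

Lemma is_LLP_extendsP n c : is_LLP n.+1 c ->
  exists2 bs, is_LLP n bs & c \in extensions n.+1 bs.
Proof.
case/andP=> c0 pc.
have : n.+1 \in flatten c by rewrite (perm_mem pc) mem_iota; lia.
case/flattenP=> B cB nB; case/path.splitPr: cB c0 pc => bs1 bs2 c0.
case/path.splitPr: nB c0 => u v c0 pc.
have puv : perm_eq (flatten bs1 ++ (u ++ v) ++ flatten bs2) (iota 1 n).
  rewrite -(perm_cons n.+1).
  rewrite -(permPr (perm_iotaS n)) -(permPr pc) flatten_cat /= -!catA.
  rewrite (catA (flatten bs1)) (catA (flatten bs1)).
by rewrite perm_sym; exact: permEl (perm_catCA _ [:: n.+1] _).
move: c0; rewrite all_cat /= => /and3P[bs10 _ bs20].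
(* If nothing else remains in the block of [n.+1], that block was a new singleton; otherwise the
   letter was inserted into an existing block. *)
case uv0 : (u ++ v) => [|y w].
  exists (bs1 ++ bs2).
    by rewrite /is_LLP all_cat bs10 bs20 flatten_cat; rewrite uv0 in puv.
  rewrite mem_cat; apply/orP; left; apply/insertionsP; exists bs1, bs2; split=> //.
  by case: u uv0 {puv pc} => //= ->.
exists (bs1 ++ (u ++ v) :: bs2).
  by rewrite /is_LLP all_cat /= bs10 bs20 flatten_cat puv uv0.
by rewrite mem_cat; apply/orP; right; apply/block_insertionsP; exists bs1, u, v, bs2.
Qed.

Lemma mem_llp_seq n bs : (bs \in llp_seq n) = is_LLP n bs.
Proof.
elim: n bs => [|n IHn] bs.
  rewrite inE /is_LLP; case: bs => [|[|x B] bs] //=.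
  by apply/esym/negP=> /andP[_ /perm_size].
apply/allpairsPdep/idP => [[b [c [bn bc ->]]]|].
  by apply: is_LLP_extensions bc; rewrite -IHn.
by case/is_LLP_extendsP=> b; rewrite -IHn; exists b, bs.
Qed.

Lemma is_LLP_notin n bs : is_LLP n bs -> n.+1 \notin flatten bs.
Proof. by case/andP=> _ /perm_mem ->; rewrite mem_iota; lia. Qed.

(** Different smaller objects have disjoint families of extensions, because [delete_letter] recovers
    the object that was extended. *)
Lemma uniq_llp_seq n : uniq (llp_seq n).
Proof.
elim: n => // n IHn; apply: allpairs_uniq_dep => // [bs|].
  by rewrite mem_llp_seq => /is_LLP_notin; apply: uniq_extensions.
move=> _ _ /allpairsPdep[b1 [c1 [b1n cb1 ->]]] /allpairsPdep[b2 [c2 [b2n cb2 ->]]].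
rewrite /= => e; rewrite -{c2}e in cb2 *.
move: b1n b2n; rewrite !mem_llp_seq => b1n b2n.
have <- // : b1 = b2.
have [/andP[b10 _] /andP[b20 _]] := (b1n, b2n).
by rewrite -(delete_letter_extensions _ _ _ b10 (is_LLP_notin _ _ b1n) cb1)
  -(delete_letter_extensions _ _ _ b20 (is_LLP_notin _ _ b2n) cb2).
Qed.

(** * The recurrence for the joint distribution *)

Definition nsb_seq (bs : seq (seq nat)) := followed_by_smaller (map minw bs).
Definition nse_seq (bs : seq (seq nat)) := \sum_(B <- bs) followed_by_smaller B.

(** An arbitrary [Q] lets the induction go through: the tail is counted with [Q] shifted by the
    contribution of the first block. *)
Lemma count_nse_block_insertions (Q : pred nat) x bs :
  all (fun z => z < x) (flatten bs) ->
  count Q (map nse_seq (block_insertions x bs)) =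
    size bs * Q (nse_seq bs) + size (flatten bs) * Q (nse_seq bs).+1.
Proof.
elim: bs Q => //= B bs IHbs Q; rewrite all_cat => /andP[ltB ltbs].
have nse_cons : map nse_seq [seq B' :: bs | B' <- insertions x B] =
    map (addn^~ (nse_seq bs)) (map followed_by_smaller (insertions x B)).
  by rewrite -!map_comp; apply: eq_map => B'; rewrite /= /nse_seq big_cons.
have nse_cons2 : map nse_seq [seq B :: c | c <- block_insertions x bs] =
    map (addn (followed_by_smaller B)) (map nse_seq (block_insertions x bs)).
  by rewrite -!map_comp; apply: eq_map => c; rewrite /= /nse_seq big_cons.
rewrite map_cat count_cat nse_cons nse_cons2 followed_by_smaller_insertions //.
rewrite [in X in _ + X]count_map IHbs //.
rewrite map_rcons map_nseq -cats1 count_cat count_nseq /= addn0.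
rewrite {5 6}/nse_seq big_cons -/(nse_seq bs) size_cat addSn addnS; lia.
Qed.

(** On the word of block minima, a new singleton block acts as the insertion of a largest letter, so
    the result on words applies. *)
Lemma count_nsb_insertions (Q : pred nat) n bs : is_LLP n bs ->
  count Q (map nsb_seq (insertions [:: n.+1] bs)) =
    Q (nsb_seq bs) + size bs * Q (nsb_seq bs).+1.
Proof.
case/andP=> bs0 pbs.
rewrite (map_comp followed_by_smaller (map minw)) map_insertions.
have -> : minw [:: n.+1] = n.+1 by apply: minw_eq => [|x]; rewrite inE // => /eqP->.
rewrite followed_by_smaller_insertions; last first.
  rewrite all_map; apply/allP => B Bbs /=.
  have : minw B \in iota 1 n; last by rewrite mem_iota; lia.
  rewrite -(perm_mem pbs); apply/flattenP; exists B => //.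
  exact/minw_mem/(allP bs0).
by rewrite -cats1 count_cat count_nseq /= size_map addn0 addnC mulnC.
Qed.

Lemma size_flatten_LLP n bs : is_LLP n bs -> size (flatten bs) = n.
Proof. by case/andP=> _ /perm_size ->; rewrite size_iota. Qed.

Lemma LLP_lt n bs : is_LLP n bs -> all (fun z => z < n.+1) (flatten bs).
Proof. by case/andP=> _ /perm_all ->; apply/allP=> x; rewrite mem_iota; lia. Qed.

Lemma count_extensions (P : nat -> nat -> nat -> bool) n bs : is_LLP n bs ->
  count (fun c => P (size c) (nsb_seq c) (nse_seq c)) (extensions n.+1 bs) =
    P (size bs).+1 (nsb_seq bs) (nse_seq bs)
    + size bs * P (size bs).+1 (nsb_seq bs).+1 (nse_seq bs)
    + (size bs * P (size bs) (nsb_seq bs) (nse_seq bs)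
       + n * P (size bs) (nsb_seq bs) (nse_seq bs).+1).
Proof.
move=> LLPbs; have /andP[bs0 pbs] := LLPbs; have ltbs := LLP_lt _ _ LLPbs.
rewrite count_cat; congr (_ + _).
  rewrite -(count_nsb_insertions (fun i => P (size bs).+1 i (nse_seq bs)) n) //.
  rewrite count_map; apply: eq_in_count => c /perm_insertions pc /=.
  rewrite (perm_size pc) /nse_seq (perm_big _ pc) big_cons.
  by rewrite followed_by_smaller_cons followed_by_smaller_nil.
rewrite -{2}(size_flatten_LLP _ _ LLPbs).
rewrite -(count_nse_block_insertions (P (size bs) (nsb_seq bs)) n.+1) //.
rewrite count_map; apply: eq_in_count => c /block_insertionsP[bs1 [u [v [bs2 [ebs ->]]]]] /=.
rewrite {}ebs in bs0 ltbs *.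
move: bs0 ltbs; rewrite all_cat flatten_cat all_cat /= all_cat.
case/and3P=> _ uv0 _ /and3P[_ ltuv _].
rewrite !size_cat /nsb_seq !map_cat /= (minw_insertions n.+1 (u ++ v)) //.
by apply/insertionsP; exists u, v.
Qed.

Definition llp_count n k i j :=
  count (fun c => [&& size c == k, nsb_seq c == i & nse_seq c == j]) (llp_seq n).

Lemma llp_countS n k i j :
  llp_count n.+1 k i j =
    (if k is k'.+1 then
       llp_count n k' i j + (if i is i'.+1 then k' * llp_count n k' i' j else 0)
     else 0)
    + (k * llp_count n k i j + (if j is j'.+1 then n * llp_count n k i j' else 0)).
Proof.
rewrite {1}/llp_count /= count_flatten -map_comp.
have -> : [seq count (fun c => [&& size c == k, nsb_seq c == i & nse_seq c == j])
                 [seq c | c <- extensions n.+1 bs] | bs <- llp_seq n] =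
  [seq ((size bs).+1 == k) && ((nsb_seq bs == i) && (nse_seq bs == j))
     + size bs * (((size bs).+1 == k) && (((nsb_seq bs).+1 == i) && (nse_seq bs == j)))
     + (size bs * ((size bs == k) && ((nsb_seq bs == i) && (nse_seq bs == j)))
       + n * ((size bs == k) && ((nsb_seq bs == i) && ((nse_seq bs).+1 == j))))
    | bs <- llp_seq n].
  apply/eq_in_map => bs; rewrite mem_llp_seq /= map_id => LLPbs.
  exact: (count_extensions (fun x y z => [&& x == k, y == i & z == j])).
rewrite /llp_count; elim: (llp_seq n) => [|bs s IHs].
  by case: k i j => [|k] [|i] [|j]; rewrite /= ?muln0.
(* The multiplicity [size bs] varies with [bs], but on the support of its indicator it is a constant
   that can leave the sum. *)
have size_eq m l (b : bool) : m * ((m == l) && b) = l * ((m == l) && b).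
  by case: eqP => [->|_] //; rewrite !muln0.
rewrite map_cons [sumn _]/= {}IHs.
by case: k i j => [|k] [|i] [|j]; rewrite /= ?eqSS ?andbF !size_eq ?muln0; lia.
Qed.

(** * Stirling numbers *)

(* [j] is [n] minus the number of cycles: this index avoids truncated
   subtractions in the recurrence. *)
Fixpoint stir1 (n j : nat) : nat :=
  if n is n'.+1 then stir1 n' j + (if j is j'.+1 then n' * stir1 n' j' else 0)
  else j == 0.

Fixpoint stir2 (n k : nat) : nat :=
  if n is n'.+1 then
    if k is k'.+1 then stir2 n' k' + k * stir2 n' k else 0
  else k == 0.

Lemma stir1_small n j : n < j -> stir1 n j = 0.
Proof.
elim: n j => [|n IHn] [|j] //= ltnj.
by rewrite !IHn ?muln0 ?(ltn_trans _ ltnj).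
Qed.

(** For [k.+1] blocks, the first two terms of the recurrence combine into [stir1 k.+1 i]. With the
    third they give [stir2 (n.+1 - j) k.+1], and the fourth then completes [stir1 n.+1 j]. *)
Lemma llp_countE n k i j :
  llp_count n k i j = stir1 n j * stir2 (n - j) k * stir1 k i.
Proof.
elim: n k i j => [|n IHn] k i j.
  rewrite /llp_count /= /nsb_seq /nse_seq big_nil followed_by_smaller_nil.
  by case: k => [|k]; case: i => [|i]; case: j => [|j]; rewrite ?muln0.
rewrite llp_countS.
case: k => [|k].
  case: j => [|j]; first by rewrite /= muln0.
  rewrite IHn /= subSS; case: (leqP n j) => [le_nj|lt_jn].
    by rewrite IHn (stir1_small n j.+1) // mul0n !add0n !mulnA.
  by rewrite IHn -(subnSK lt_jn) /= !muln0.
rewrite !IHn; case: j => [|j].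
  by rewrite !subn0; case: i => [|i] /=; rewrite ?IHn ?subn0 ?addn0; lia.
(* For [n <= j] the subtraction [n - j.+1] is truncated and the recurrence of [stir2] does not
   apply, but there the factor [stir1 n j.+1] vanishes. *)
rewrite subSS IHn; case: (leqP n j) => [le_nj|lt_jn].
  rewrite /= (stir1_small n j.+1) //.
  by case: i => [|i]; rewrite ?IHn ?(stir1_small n j.+1) //=; lia.
by rewrite -(subnSK lt_jn); case: i => [|i] /=; rewrite ?IHn; lia.
Qed.

(** * Cycles of permutations and Stirling numbers of the first kind *)

Section PermutationCycles.
Local Open Scope group_scope.

Lemma lift_perm_expg_lift n (i : 'I_n.+1) (s : 'S_n) m x :
  (lift_perm i i s ^+ m) (lift i x) = lift i ((s ^+ m) x).
Proof.
elim: m => [|m IHm]; first by rewrite !expg0 !perm1.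
by rewrite !expgSr !permM IHm lift_perm_lift.
Qed.

Lemma porbit_lift_perm_lift n (i : 'I_n.+1) (s : 'S_n) x :
  porbit (lift_perm i i s) (lift i x) = lift i @: porbit s x.
Proof.
apply/setP=> y; apply/porbitP/imsetP => [[m ->]|[_ /porbitP[m ->] ->]].
  by exists ((s ^+ m) x); rewrite ?mem_porbit ?lift_perm_expg_lift.
by exists m; rewrite lift_perm_expg_lift.
Qed.

Lemma porbit_lift_perm_id n (i : 'I_n.+1) (s : 'S_n) :
  porbit (lift_perm i i s) i = [set i].
Proof.
apply/setP=> y; rewrite inE; apply/porbitP/eqP => [[m ->]|->].
  elim: m => [|m IHm]; first by rewrite expg0 perm1.
  by rewrite expgSr permM IHm lift_perm_id.
by exists 0; rewrite expg0 perm1.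
Qed.

(** [lift_perm i i s] is [s] with an added fixed point [i]: its orbits are the lifted orbits of [s]
    and the singleton of [i], which is no lifted orbit because [lift i] misses [i]. *)
Lemma card_porbits_lift_perm n (i : 'I_n.+1) (s : 'S_n) :
  #|porbits (lift_perm i i s)| = #|porbits s|.+1.
Proof.
have -> : porbits (lift_perm i i s) =
    [set i] |: [set lift i @: (X : {set 'I_n}) | X in porbits s].
  apply/setP=> X; rewrite !inE; apply/imsetP/predU1P.
    case=> x _ ->; case: (unliftP i x) => [x'|] ->; last by left; apply: porbit_lift_perm_id.
    by right; rewrite porbit_lift_perm_lift imset_f // imset_f.
  case=> [->|/imsetP[_ /imsetP[x _ ->] ->]].
    by exists i; rewrite ?porbit_lift_perm_id.
  by exists (lift i x); rewrite ?porbit_lift_perm_lift.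
rewrite cardsU1 card_imset; last exact/imset_inj/lift_inj.
case: imsetP => // -[X _ /setP/(_ i)].
rewrite set11 => /esym/imsetP[x _ e].
by have := neq_lift i x; rewrite -e eqxx.
Qed.

(** Since [i] is a fixed point, the transposition merges its cycle into that of [x] when [x != i],
    which costs one cycle. *)
Lemma card_porbits_tperm_lift_perm n (i x : 'I_n.+1) (s : 'S_n) :
  (#|porbits (tperm x i * lift_perm i i s)| + (x != i) = #|porbits s|.+1)%N.
Proof.
have := porbits_mul_tperm (lift_perm i i s) x i.
rewrite card_porbits_lift_perm porbit_lift_perm_id inE /=.
by case: eqVneq => /= _; rewrite -muln2; set a := #|porbits _|; lia.
Qed.

(** The point [x] is recovered as the preimage of [i], and cancelling the transposition then
    recovers [s]. Surjectivity follows from [n.+1 * n! = (n.+1)!]. *)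
Lemma tperm_lift_perm_bij n (i : 'I_n.+1) :
  bijective (fun p : 'I_n.+1 * 'S_n => tperm p.1 i * lift_perm i i p.2).
Proof.
apply: inj_card_bij => [[x s] [y t] /= e|]; last first.
  by rewrite card_prod card_ord !card_Sn factS.
have exy : x = y.
  apply: (@perm_inj _ (tperm y i * lift_perm i i t)).
  by rewrite -{1}e !permM !tpermL !lift_perm_id.
rewrite {}exy in e *; have {e} := mulgI _ _ _ e => /permP e; congr pair.
by apply/permP=> z; apply: (@lift_inj _ i); rewrite -(lift_perm_lift i i s) e lift_perm_lift.
Qed.

Definition perms_defect n j := [set s : 'S_n | #|porbits s| + j == n]%N.

Lemma card_porbits_le n (s : 'S_n) : #|porbits s| <= n.
Proof. by rewrite (leq_trans (leq_imset_card _ _)) ?card_ord. Qed.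

(** Along the bijection above, [x = ord_max] keeps the defect [j], and each of the [n] other choices
    of [x] raises it by one. *)
Lemma card_perms_defectS n j : #|perms_defect n.+1 j| =
  (#|perms_defect n j| + (if j is j'.+1 then n * #|perms_defect n j'| else 0))%N.
Proof.
have bij := tperm_lift_perm_bij n ord_max.
rewrite -!sum1dep_card (reindex _ (onW_bij _ bij)) /=.
rewrite (eq_bigl (fun p : 'I_n.+1 * 'S_n =>
  (#|porbits p.2|.+1 + j == n.+1 + (p.1 != ord_max)))%N); last first.
  case=> x s /=.
  by rewrite -(card_porbits_tperm_lift_perm n ord_max x s) addnAC eqn_add2r.
rewrite -(pair_big_dep xpredT
  (fun x s => #|porbits s|.+1 + j == n.+1 + (x != ord_max))%N (fun _ _ => 1%N)) /=.
rewrite (bigD1 ord_max) //= eqxx; congr (_ + _)%N.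
  by apply: eq_bigl => s; rewrite /= addn0.
case: j => [|j].
  (* Defect zero with [x != ord_max] would require [n.+1] cycles on [n] points. *)
  rewrite big1 // => x ->; rewrite big1 // => s.
  by rewrite addn0 addn1 eqSS => /eqP es; have := card_porbits_le n s; rewrite es ltnn.
rewrite (eq_bigr (fun _ => #|perms_defect n j|)) => [|x ->].
  by rewrite sum_nat_const cardC1 card_ord.
rewrite -sum1dep_card; apply: eq_bigl => s.
by rewrite addn1 addSn addnS !eqSS.
Qed.

Lemma card_perms_defect n j : #|perms_defect n j| = stir1 n j.
Proof.
elim: n j => [|n IHn] j; last by rewrite card_perms_defectS IHn; case: j => //= j; rewrite IHn.
rewrite /=; case: j => [|j].
  rewrite -[RHS](card_Sn 0); apply: eq_card => s; rewrite !inE addn0.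
  by rewrite -leqn0 card_porbits_le.
by apply: eq_card0 => s; rewrite !inE addnS.
Qed.

Lemma stirling1E n j : j <= n -> stirling1 n (n - j) = stir1 n j.
Proof.
move=> le_jn; rewrite -card_perms_defect; apply: eq_card => s; rewrite !inE.
by lia.
Qed.

End PermutationCycles.

(** * Set partitions and Stirling numbers of the second kind *)

Definition partitions_card {T : finType} (D : {set T}) k :=
  [set P : {set {set T}} | partition P D & #|P| == k].

Lemma card_partitions_singleton {T : finType} (D : {set T}) (x : T) k : x \notin D ->
  #|[set P in partitions_card (x |: D) k.+1 | [set x] \in P]| =
    #|partitions_card D k|.
Proof.
move=> xND; have xNP (P : {set {set T}}) : partition P D -> [set x] \notin P.
  by move=> PD; apply/negP=> /(partitionS PD); rewrite sub1set (negPf xND).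
rewrite -[RHS](card_in_imset (f := setU [set [set x]])); last first.
  move=> P Q; rewrite !inE => /andP[/xNP PD _] /andP[/xNP QD _].
  by move/(congr1 (fun R => R :\ [set x])); rewrite !setU1K.
apply: eq_card => P; rewrite inE; apply/andP/imsetP; last first.
  case=> Q; rewrite !inE => /andP[QD /eqP cQ] ->.
  rewrite partitionU1 ?cardsU1 ?cQ ?xNP ?setU11 ?eqxx ?disjoints1 //.
  by rewrite -card_gt0 cards1.
rewrite inE; case=> /andP[PxD /eqP cP] xP.
exists (P :\ [set x]); last by rewrite setD1K.
rewrite inE -eqSS -cP [in X in _ == X](cardsD1 [set x]) xP.
by have := partitionD1 PxD xP; rewrite setU1K // => ->; rewrite eqxx.
Qed.

(** Such a partition amounts to a partition of [D] with a marked block, the one that [x] joins;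
    there are [k] ways to mark. *)
Lemma card_partitions_nonsingleton {T : finType} (D : {set T}) (x : T) k : x \notin D ->
  #|[set P in partitions_card (x |: D) k | [set x] \notin P]| =
    k * #|partitions_card D k|.
Proof.
move=> xND; pose pairs := [set QB : {set {set T}} * {set T} |
  (QB.1 \in partitions_card D k) && (QB.2 \in QB.1)].
have -> : k * #|partitions_card D k| = #|pairs|.
  transitivity (\sum_(Q in partitions_card D k) \sum_(B in Q) 1).
    rewrite (eq_bigr (fun _ => k)) ?sum_nat_const 1?mulnC // => Q.
    by rewrite inE sum1_card => /andP[_ /eqP].
  by rewrite pair_big_dep -sum1dep_card.
(* [f] puts [x] into the marked block; its inverse [g] takes [x] out of its block and marks what is
   left. *)
pose f (QB : {set {set T}} * {set T}) := (x |: QB.2) |: (QB.1 :\ QB.2).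
pose g (P : {set {set T}}) := let B := pblock P x :\ x in (B |: (P :\ pblock P x), B).
have fP Q B : partition Q D -> B \in Q ->
    [/\ partition (f (Q, B)) (x |: D), #|f (Q, B)| = #|Q|, [set x] \notin f (Q, B)
      & g (f (Q, B)) = (Q, B)].
  move=> QD QB; have BD := partitionS QD QB.
  have xNB : x \notin B by apply: contra xND => /(subsetP BD).
  have xNQ (C : {set T}) : x \in C -> C \notin Q.
    by move=> xC; apply: contra xND => /(partitionS QD)/subsetP->.
  have xBNQ : x |: B \notin Q :\ B by rewrite inE negb_and xNQ ?setU11 ?orbT.
  have fD : partition (f (Q, B)) (x |: D).
    have -> : x |: D = (x |: B) :|: (D :\: B).
      by rewrite -setUA -{1}(setID D B) (setIidPr BD).
    apply: partitionU1; first exact: partitionD1.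
      by apply/set0Pn; exists x; rewrite setU11.
    rewrite -setI_eq0; apply/eqP/setP=> y; rewrite !inE.
    by case: eqVneq => [->|_]; rewrite ?(negPf xND) ?andbF //=; case: (y \in B).
  split=> //.
  - by rewrite cardsU1 xBNQ (cardsD1 B Q) QB.
  - rewrite !inE negb_or negb_and xNQ ?set11 // orbT andbT.
    have /set0Pn[y yB] := partition_neq0 QD QB.
    apply/eqP=> /setP/(_ y); rewrite !inE yB orbT => /eqP exy.
    by rewrite -exy yB in xNB.
  - rewrite /g (@def_pblock _ _ (x |: B)) ?setU11 //; last exact: partition_trivIset fD.
    by rewrite !setU1K // setD1K.
have gP P : partition P (x |: D) -> [set x] \notin P ->
    [/\ partition (g P).1 D, (g P).2 \in (g P).1 & f (g P) = P].
  move=> PD x1NP; set B := pblock P x.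
  have xcP : x \in cover P by rewrite (cover_partition PD) setU11.
  have xB : x \in B by rewrite mem_pblock.
  have BP : B \in P by rewrite pblock_mem.
  have BD := partitionS PD BP.
  (* Because [x] is not alone, its block stays nonempty after the removal. *)
  have B'0 : B :\ x != set0.
    apply: contra x1NP => /eqP B'0; suff <- : B = [set x] by [].
    by rewrite -(setD1K xB) B'0 setU0.
  have PBD := partitionD1 PD BP.
  have B'dis : [disjoint B :\ x & (x |: D) :\: B].
    by rewrite -setI_eq0; apply/eqP/setP=> y; rewrite !inE; case: (y \in B); rewrite ?andbF.
  split; rewrite /g -/B ?setU11 //=.
    have -> : D = (B :\ x) :|: ((x |: D) :\: B).
      apply/setP=> y; rewrite !inE; have [->|y_neq_x] /= := eqVneq y x.
        by rewrite xB (negPf xND).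
      case yB: (y \in B) => //=.
      by have := subsetP BD _ yB; rewrite !inE (negPf y_neq_x).
    exact: partitionU1.
  rewrite /f /= setD1K // setU1K ?setD1K //.
  (* The shrunken block is disjoint from the union of the other blocks, so it could be one of them
     only if it were empty. *)
  apply/negP=> /(partitionS PBD) B'S; case/negP: B'0.
  by rewrite -(setIidPl B'S) setI_eq0.
rewrite -[RHS](card_in_imset (f := f)); last first.
  apply: (can_in_inj (g := g)) => -[Q B]; rewrite !inE => /andP[/andP[QD _] QB].
  by case: (fP Q B QD QB).
apply: eq_card => P; rewrite inE; apply/andP/imsetP.
  rewrite inE => -[/andP[PD /eqP cP] x1NP].
  have [] := gP P PD x1NP; case: (g P) => Q B /= QD QB fQB.
  exists (Q, B) => //; rewrite !inE /= QD QB andbT -cP -fQB.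
  by have [_ -> _ _] := fP Q B QD QB; rewrite eqxx.
case=> -[Q B]; rewrite !inE /= => /andP[/andP[QD /eqP cQ] QB] ->.
by have [-> -> -> _] := fP Q B QD QB; rewrite cQ eqxx.
Qed.

Lemma card_partitions_setU1 {T : finType} (D : {set T}) (x : T) k : x \notin D ->
  #|partitions_card (x |: D) k.+1| =
    #|partitions_card D k| + k.+1 * #|partitions_card D k.+1|.
Proof.
move=> xND; rewrite -(card_partitions_singleton D x) // -(card_partitions_nonsingleton D x) //.
rewrite -(cardsID [set P : {set {set T}} | [set x] \in P]).
by congr (_ + _); apply: eq_card => P; rewrite !inE // andbC.
Qed.

(** The statement covers all subsets [D] of a fixed type, so that a point can be removed without
    changing the type. *)
Lemma card_partitions {T : finType} (D : {set T}) k :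
  #|partitions_card D k| = stir2 #|D| k.
Proof.
elim: {D}#|D| {-2}D (erefl #|D|) k => [|n IHn] D cD k.
  move/eqP: cD; rewrite cards_eq0 => /eqP->; rewrite cards0.
  case: k => [|k] /=.
    apply: (etrans _ (cards1 (set0 : {set {set T}}))); apply: eq_card => P.
    by rewrite !inE partition_set0 andb_idr // => /eqP ->; rewrite cards0.
  by apply: eq_card0 => P; rewrite !inE partition_set0; case: eqP => // ->; rewrite cards0.
have /set0Pn[x xD] : D != set0 by rewrite -card_gt0 cD.
have xND : x \notin D :\ x by rewrite !inE eqxx.
have cD' : #|D :\ x| = n by have := cardsD1 x D; rewrite xD cD => -[].
rewrite cD; case: k => [|k] /=; last first.
  by rewrite -(setD1K xD) card_partitions_setU1 // !IHn // cD'.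
apply: eq_card0 => P; rewrite !inE; apply/andP=> -[/cover_partition].
move=> + /eqP/cards0_eq P0; rewrite P0 /cover big_set0 => D0.
by rewrite -D0 inE in xD.
Qed.

Lemma stirling2E n k : stirling2 n k = stir2 n k.
Proof. by rewrite -[n in RHS]card_ord -[#|'I_n|]cardsT -card_partitions. Qed.

(** * The four statistics on LLP *)

Lemma uniq_map_minw bs : all (fun B => B != [::]) bs -> uniq (flatten bs) ->
  uniq (map minw bs).
Proof.
elim: bs => //= B bs IHbs /andP[B0 bs0]; rewrite cat_uniq => /and3P[_ dBbs ubs].
rewrite IHbs // andbT; apply/mapP=> -[B' B'bs eB]; case/hasP: dBbs.
exists (minw B); last exact: minw_mem.
by apply/flattenP; exists B'; rewrite // eB minw_mem // (allP bs0).
Qed.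

(** The block minima are distinct, and exactly one of them, the letter 1, is counted by neither
    statistic. The size [n.+1] ensures that 1 occurs. *)
Lemma rlb_nsb_LLP n bs : is_LLP n.+1 bs ->
  (rlmin_above 1 (map minw bs) + nsb_seq bs).+1 = size bs.
Proof.
case/andP=> bs0 pbs.
have le1 : all (leq 1) (map minw bs).
  rewrite all_map; apply/allP=> B Bbs /=.
  have : minw B \in iota 1 n.+1; last by rewrite mem_iota => /andP[].
  rewrite -(perm_mem pbs); apply/flattenP; exists B => //.
  exact/minw_mem/(allP bs0).
have ubs : uniq (map minw bs).
  by rewrite uniq_map_minw // (perm_uniq pbs) iota_uniq.
have m1 : 1 \in map minw bs.
  have : 1 \in flatten bs by rewrite (perm_mem pbs) mem_iota.
  case/flattenP=> B Bbs B1; apply/mapP; exists B => //; apply/eqP.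
  rewrite eqn_leq minw_le // andbT.
  by apply: (allP le1); apply: map_f.
by rewrite -[RHS](size_map minw) -(rlmin_above_followed_by_smaller 1) // m1 addn1.
Qed.

(** In each block only the minimum is counted by neither statistic, so the deficit is the number of
    blocks. *)
Lemma rle_nse_LLP n bs : is_LLP n bs ->
  \sum_(B <- bs) rlmin_above (minw B) B + nse_seq bs + size bs = n.
Proof.
move=> LLPbs; rewrite -[RHS](size_flatten_LLP _ _ LLPbs).
case/andP: LLPbs => bs0 /perm_uniq; rewrite iota_uniq /nse_seq.
elim: bs bs0 => [|B bs IHbs] /=; first by rewrite !big_nil.
case/andP=> B0 bs0; rewrite cat_uniq => /and3P[uB _ ubs].
rewrite !big_cons size_cat -IHbs //.
rewrite -(rlmin_above_followed_by_smaller (minw B) B) ?minw_mem //; first by lia.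
by apply/allP=> x /minw_le.
Qed.

(** * Transfer to the finite carrier type and to the polynomial *)

Lemma blocks_inj n m : injective (@blocks n m).
Proof.
move=> p q /inj_map e; apply: val_inj; apply: e => B C /inj_map e.
by apply: val_inj; apply: e; apply: val_inj.
Qed.

(** Blocks have length at most [n] and letters below [n.+1], so neither [insub_bseq] nor [inord]
    falls back to its default. *)
Lemma is_LLP_blocks n bs : is_LLP n bs ->
  exists p : llp_carrier n (size bs), blocks p = bs.
Proof.
move=> LLPbs; pose word B : n.-bseq 'I_n.+1 := insub_bseq n (map inord B).
have size_word : size (map word bs) == size bs by rewrite size_map.
exists (Tuple size_word); rewrite /blocks /= -map_comp.
rewrite -[RHS]map_id; apply/eq_in_map=> B Bbs /=.
have leB : size B <= n.
  case/path.splitPr: Bbs LLPbs => bs1 bs2 /size_flatten_LLP <-.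
  by rewrite flatten_cat !size_cat /=; lia.
have -> : bseqval (word B) = map inord B by apply: insubdK; rewrite unfold_in size_map.
rewrite -map_comp -[RHS]map_id; apply/eq_in_map=> x xB /=.
by rewrite inordK // (allP (LLP_lt _ _ LLPbs)) //; apply/flattenP; exists B.
Qed.

Lemma card_LLP_nsb_nse n k i j :
  #|[set p in LLP n k | (nsb p == i) && (nse p == j)]| = llp_count n k i j.
Proof.
rewrite /llp_count -size_filter cardE -(size_map (@blocks n k)); apply: perm_size.
apply: uniq_perm; first by rewrite map_inj_uniq ?enum_uniq //; apply: blocks_inj.
  by rewrite filter_uniq // uniq_llp_seq.
move=> bs; rewrite mem_filter mem_llp_seq; apply/mapP/andP => [[p]|[/and3P[/eqP <- nsbi nsej]]].
  rewrite mem_enum !inE => /andP[LLPp /andP[nsbi nsej]] ->.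
  by split=> //; rewrite size_map size_tuple eqxx; apply/and3P.
move=> LLPbs; have [p pbs] := is_LLP_blocks n bs LLPbs.
exists p => //; rewrite mem_enum !inE pbs LLPbs.
by rewrite /nsb /nse pbs -/(nsb_seq bs) -/(nse_seq bs) nsbi nsej.
Qed.

Lemma coef_SS n m (a b c d : nat) :
  ((SS n m)@_[multinom [tuple a; b; c; d]] =
    #|[set p in LLP n m | [&& rlb p == a, nsb p == b, rle p == c & nse p == d]]|%:R)%R.
Proof.
rewrite /SS GRing.raddf_sum -sum1dep_card GRing.natr_sum [RHS]big_mkcondr /=.
apply: eq_bigr => p _.
(* Each [p] contributes the single monomial with exponent [e], whose coefficient is an indicator. *)
set e := [multinom [tuple rlb p; nsb p; rle p; nse p]].
have -> : ('X_(inord 0) ^+ rlb p * 'X_(inord 1) ^+ nsb p * 'X_(inord 2) ^+ rle p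
    * 'X_(inord 3) ^+ nse p)%R = 'X_[int, e].
  have eE (l : 'I_4) : e l = nth 0 [:: rlb p; nsb p; rle p; nse p] l.
    by rewrite multinomE (tnth_nth 0).
  rewrite [RHS]mpolyXE_id !big_ord_recl big_ord0 GRing.mulr1 !GRing.mulrA !eE /=.
  have ord0E : ord0 = inord 0 :> 'I_4 by apply: val_inj; rewrite /= inordK.
  have ord1E : lift ord0 ord0 = inord 1 :> 'I_4 by apply: val_inj; rewrite /= inordK.
  have ord2E : lift ord0 (lift ord0 ord0) = inord 2 :> 'I_4.
    by apply: val_inj; rewrite /= inordK.
  have ord3E : lift ord0 (lift ord0 (lift ord0 ord0)) = inord 3 :> 'I_4.
    by apply: val_inj; rewrite /= inordK.
  by rewrite ord3E ord2E ord1E ord0E.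
rewrite mcoeffX -[in RHS]GRing.mulrb; congr ((nat_of_bool _)%:R)%R.
apply/eqP/and4P => [/(congr1 (fun m : 'X_{1.. 4} => tval (multinom_val m)))|].
  by case=> -> -> -> ->.
by rewrite /e => -[/eqP-> /eqP-> /eqP-> /eqP->].
Qed.

Theorem theorem4p3 (n k i j : nat)
    (hk : (1 <= k <= n)%N) (hi : (i <= k - 1)%N) (hj : (j <= n - k)%N) :
  let A := [set p in LLP n k | [&& rlb p == (k - 1 - i)%N, nsb p == i,
                                   rle p == (n - k - j)%N & nse p == j]] in
  ((SS n k)@_[multinom [tuple (k - 1 - i)%N; i; (n - k - j)%N; j]] = #|A|%:R)%R
  /\ #|A| = (stirling1 n (n - j) * stirling2 (n - j) k * stirling1 k (k - i))%N.
Proof.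
move=> A; split; first exact: coef_SS.
rewrite !stirling1E ?stirling2E -?llp_countE -?card_LLP_nsb_nse; try lia.
(* It remains to see that the conditions on [rlb] and [rle] follow from those on [nsb] and [nse], by
   the two sum identities. *)
apply: eq_card => p; rewrite !inE; apply: andb_id2l => LLPp.
have size_p : size (blocks p) = k by rewrite size_map size_tuple.
have rle_nse : rle p + nse p + k = n by rewrite -[RHS](rle_nse_LLP _ _ LLPp) size_p.
(* The identity for [rlb] needs a positive size, which [1 <= k <= n] provides. *)
case: n hk hj A p LLPp size_p rle_nse => [|n] hk hj A p LLPp size_p rle_nse; first by lia.
have rlb_nsb : (rlb p + nsb p).+1 = k by rewrite -[RHS]size_p -(rlb_nsb_LLP _ _ LLPp).
by apply/and4P/andP=> [[_ -> _ ->]|[/eqP nsbi /eqP nsej]]; split=> //; lia.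
Qed.
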